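(* Let $n\ge 2$, $m=n^2-1$, and let $D\subseteq B(n,n,n)$ be a diagonal. Then for all $(g_1,g_2,g_3)\in \operatorname{GL}_m(\mathbb{C})^3$ and all $w\in\otimes^3\mathbb{C}^m$, $$F_{m,D}\big((g_1\otimes g_2\otimes g_3)w\big)=\big(\det(g_1)\det(g_2)\det(g_3)\big)^n F_{m,D}(w).$$ Thus $F_{m,D}$ is invariant under the action of $\operatorname{SL}_m(\mathbb{C})^3$. Moreover, $F_{m,D}\neq 0$.
   Context: $[n]=\{1,\dots,n\}$ and $B(n,n,n)=[n]^3$. A diagonal of $B(n,n,n)$ is a subset $D=\{(i,\sigma(i),\tau(i))\mid i\in[n]\}$ with $\sigma,\tau\in S_n$. Let $H_D=B(n,n,n)\setminus D$, so $d:=|H_D|=n^3-n$; order $H_D$ lexicographically and thereby identify $H_D$ with $[d]$. For $k\in\{1,2,3\}$ and $i\in[n]$ the slice $\mathbf{e}_i^{(k)}\subseteq H_D$ is the set of points of $H_D$ whose $k$-th coordinate equals $i$; it has $n^2-1=m$ elements. For $w=(w_s)_{s\in[d]}$ with $w_s=(w_s^{(1)},w_s^{(2)},w_s^{(3)})\in(\mathbb{C}^m)^3$ put $$\operatorname{val}_{H_D}(w)=\prod_{k=1}^3\prod_{i=1}^n\det\big(w^{(k)}_{s_1},\dots,w^{(k)}_{s_m}\big),$$ where $s_1<\dots<s_m$ are the elements of $\mathbf{e}^{(k)}_i$. This is multilinear in all the vectors $w^{(k)}_s$, hence defines a linear functional $\operatorname{val}_{H_D}$ on $\otimes^d(\otimes^3\mathbb{C}^m)$,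 with $w$ corresponding to $\otimes_{s=1}^d(w_s^{(1)}\otimes w_s^{(2)}\otimes w_s^{(3)})$. The homogeneous polynomial $F_{m,D}$ of degree $d$ on $\otimes^3\mathbb{C}^m$ is $F_{m,D}(t)=\operatorname{val}_{H_D}(t^{\otimes d})$; explicitly, if $t=\sum_{i=1}^r t_i$ with $t_i=t_i^{(1)}\otimes t_i^{(2)}\otimes t_i^{(3)}$, then $F_{m,D}(t)=\sum_{I:[d]\to[r]}\operatorname{val}_{H_D}(t_{I(1)}\otimes\cdots\otimes t_{I(d)})$. *)

(* Defs.v *)
From HB Require Import structures.
From mathcomp Require Import all_boot all_order all_fingroup all_algebra.
From mathcomp Require Import reals complex.

Set Implicit Arguments.
Unset Strict Implicit.
Unset Printing Implicit Defensive.

Import Order.TTheory GRing.Theory.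

Local Open Scope ring_scope.

(** Points of [B(n,n,n)], with coordinates in {0, ..., n-1}, as 3-tuples
    carrying the lexicographic (total) order. *)
Definition point (n : nat) := 3.-tuplelexi 'I_n.

Definition coord (n : nat) (x : point n) (k : 'I_3) : 'I_n :=
  tnth (x : 3.-tuple 'I_n) k.

Definition is_diagonal (n : nat) (D : {set point n}) : Prop :=
  exists sigma tau : 'S_n,
    D = [set ([tuple i; sigma i; tau i] : point n) | i : 'I_n].

Definition HD (n : nat) (D : {set point n}) : {set point n} := ~: D.

Definition deg (n : nat) (D : {set point n}) : nat := #|HD D|.

(** [Order.enum_val] is the increasing enumeration of [HD D]; through it a
    slice is a set of positions in {0, ..., deg D - 1}. *)
Definition slice (n : nat) (D : {set point n}) (k : 'I_3) (i : 'I_n) :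
    {set 'I_(deg D)} :=
  [set s | coord (Order.enum_val (A := mem (HD D)) s) k == i].

Definition mdim (n : nat) : nat := (n ^ 2 - 1)%N.

(** [detcols m vs] is the determinant of the matrix whose columns are the
    entries of [vs]; it is only used for lists of length [m] (see
    [card_slice]), so the default value of [nth] plays no role. *)
Definition detcols (K : comNzRingType) (m : nat) (vs : seq 'cV[K]_m) : K :=
  \det (\matrix_(a < m, b < m) (nth 0 vs b) a 0).

(** [enum] lists a set of ordinals in increasing order. *)
Definition valH (K : comNzRingType) (n : nat) (D : {set point n})
    (w : 'I_(deg D) -> 'I_3 -> 'cV[K]_(mdim n)) : K :=
  \prod_(k < 3) \prod_(i < n) detcols [seq w s k | s <- enum (slice D k i)].

(** The [p]-th tensor power of the free module with basis [T], in coordinates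
    with respect to the basis [e_(J 0) (x) ... (x) e_(J (p-1))]. *)
Definition tens (K : comNzRingType) (p : nat) (T : finType) :=
  {ffun {ffun 'I_p -> T} -> K}.

Definition tens3 (K : comNzRingType) (m : nat) := tens K 3 'I_m.

Definition tensd (K : comNzRingType) (d m : nat) :=
  tens K d {ffun 'I_3 -> 'I_m}.

Definition pure3 (K : comNzRingType) (m : nat) (v : 'I_3 -> 'cV[K]_m) :
    tens3 K m :=
  [ffun x : {ffun 'I_3 -> 'I_m} => \prod_(k < 3) v k (x k) 0].

Definition pured (K : comNzRingType) (d m : nat) (t : 'I_d -> tens3 K m) :
    tensd K d m :=
  [ffun J : {ffun 'I_d -> {ffun 'I_3 -> 'I_m}} => \prod_(s < d) t s (J s)].

Definition tpow (K : comNzRingType) (d m : nat) (t : tens3 K m) : tensd K d m :=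
  pured (fun=> t).

(** The linear functional on [(C^m (x) C^m (x) C^m)^(x) d] induced by the
    multilinear [valH]: it takes the value [valH] on tensors of basis vectors,
    hence (lemma [valL_pure]) on all pure tensors. *)
Definition valL (K : comNzRingType) (n : nat) (D : {set point n})
    (T : tensd K (deg D) (mdim n)) : K :=
  \sum_(J : {ffun 'I_(deg D) -> {ffun 'I_3 -> 'I_(mdim n)}})
    T J * valH (fun s k => delta_mx (J s k) 0).

Definition F (K : comNzRingType) (n : nat) (D : {set point n})
    (t : tens3 K (mdim n)) : K :=
  valL (tpow (deg D) t).

(** [tact g] is [g 0 (x) g 1 (x) g 2]; see [tact_pure]. *)
Definition tact (K : comNzRingType) (m : nat) (g : 'I_3 -> 'M[K]_m)
    (t : tens3 K m) : tens3 K m :=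
  [ffun x : {ffun 'I_3 -> 'I_m} =>
     \sum_(y : {ffun 'I_3 -> 'I_m}) (\prod_(k < 3) g k (x k) (y k)) * t y].

Lemma tact_pure (K : comNzRingType) (m : nat) (g : 'I_3 -> 'M[K]_m)
    (v : 'I_3 -> 'cV[K]_m) :
  tact g (pure3 v) = pure3 (fun k => g k *m v k).
Proof.
apply/ffunP => x; rewrite !ffunE.
under [RHS]eq_bigr do rewrite mxE.
rewrite bigA_distr_bigA; apply: eq_bigr => y _.
by rewrite ffunE -big_split.
Qed.

Lemma card_coord (n : nat) (k : 'I_3) (i : 'I_n) :
  #|[set x : point n | coord x k == i]| = (n ^ 2)%N.
Proof.
pose A (l : 'I_3) : pred 'I_n := if l == k then pred1 i else predT.
pose f (x : point n) : {ffun 'I_3 -> 'I_n} := [ffun l => coord x l].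
have fI : injective f.
  by move=> x y /ffunP e; apply: eq_from_tnth => l; have := e l; rewrite !ffunE.
rewrite -(card_imset _ fI).
have -> : #|[set f x | x in [set x : point n | coord x k == i]]| =
          #|(family A : {pred {ffun 'I_3 -> 'I_n}})|.
  apply: eq_card => h; apply/imsetP/familyP => [[x] | hA].
    rewrite inE => /eqP xi -> l; rewrite ffunE /A.
    by case: eqP => // ->; rewrite inE /= xi.
  exists ([tuple h l | l < 3] : point n); last first.
    by apply/ffunP => l; rewrite ffunE /coord tnth_mktuple.
  by rewrite inE /coord tnth_mktuple; have := hA k; rewrite /A eqxx.
rewrite card_family foldrE big_map big_enum /= (bigD1 k) //= {1}/A eqxx card1 mul1n.
rewrite (eq_bigr (fun=> n)); last first.
  by move=> l /negbTE lk; rewrite /A lk card_ord.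
rewrite prod_nat_const; congr (n ^ _)%N.
by have := cardC1 k; rewrite card_ord.
Qed.

Lemma card_coord_diag (n : nat) (D : {set point n}) (k : 'I_3) (i : 'I_n) :
  is_diagonal D -> #|[set x in D | coord x k == i]| = 1%N.
Proof.
move=> [sigma [tau ->]].
have [p pE] : exists p : 'S_n,
    forall j, coord ([tuple j; sigma j; tau j] : point n) k = p j.
  case: k => -[|[|[|//]]] lk; [exists 1%g|exists sigma|exists tau] => j;
  by rewrite /coord (tnth_nth j) ?perm1.
apply/eqP/cards1P.
pose j := (p^-1)%g i; exists ([tuple j; sigma j; tau j] : point n).
apply/setP => x; rewrite !inE; apply/andP/eqP => [[/imsetP[l _ ->]] | ->].
  by rewrite pE => /eqP pl; rewrite /j -pl permK.
by rewrite pE permKV eqxx; split=> //; apply: imset_f.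
Qed.

Lemma card_slice (n : nat) (D : {set point n}) (k : 'I_3) (i : 'I_n) :
  is_diagonal D -> #|slice D k i| = mdim n.
Proof.
move=> hD; have := cardsID D [set x | coord x k == i]; rewrite card_coord.
rewrite [X in (X + _)%N](_ : _ = #|[set x in D | coord x k == i]|); last first.
  by apply: eq_card => x; rewrite !inE andbC.
rewrite card_coord_diag // /mdim => <-.
rewrite add1n subn1 -(card_imset _ (@Order.enum_val_inj _ _ (mem (HD D)))).
apply: eq_card => x; rewrite !inE; apply/imsetP/andP => [[s]|[xD xi]].
  rewrite inE => si ->; split=> //.
  by have := Order.enum_valP s; rewrite inE.
have xH : x \in HD D by rewrite inE.
exists (Order.enum_rank_in xH x); last by rewrite Order.enum_rankK_in.
by rewrite inE Order.enum_rankK_in.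
Qed.

Lemma deg_diag (n : nat) (D : {set point n}) :
  is_diagonal D -> deg D = (n ^ 3 - n)%N.
Proof.
move=> [sigma [tau ->]]; rewrite /deg /HD cardsCs setCK card_tuple card_ord.
rewrite card_imset ?card_ord // => i j /(congr1 val) /=.
by case.
Qed.

Lemma valHE (K : comNzRingType) (n : nat) (D : {set point n}) :
  is_diagonal D ->
  exists Q : {ffun 'I_3 * 'I_n -> 'S_(mdim n)} ->
             {ffun 'I_(deg D) -> {ffun 'I_3 -> 'I_(mdim n)}},
  forall w : 'I_(deg D) -> 'I_3 -> 'cV[K]_(mdim n),
  valH w = \sum_(P : {ffun 'I_3 * 'I_n -> 'S_(mdim n)})
    (\prod_ki (-1) ^+ P ki) * \prod_s \prod_k w s k (Q P s k) 0.
Proof.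
move=> hD; have cS k i := card_slice k i hD.
pose c (s : 'I_(deg D)) k := coord (Order.enum_val (A := mem (HD D)) s) k.
have cP s k : s \in slice D k (c s k) by rewrite inE.
pose r (s : 'I_(deg D)) k : 'I_(mdim n) := cast_ord (cS _ _) (enum_rank_in (cP s k) s).
exists (fun P : {ffun 'I_3 * 'I_n -> 'S_(mdim n)} =>
  [ffun s : 'I_(deg D) => [ffun k : 'I_3 => P (k, c s k) (r s k)]]) => w.
rewrite /valH pair_bigA /=.
pose sg (ki : 'I_3 * 'I_n) (b : 'I_(mdim n)) : 'I_(deg D) :=
  enum_val (cast_ord (esym (cS ki.1 ki.2)) b).
have E ki : detcols [seq w s ki.1 | s <- enum (slice D ki.1 ki.2)] =
    \sum_(p : 'S_(mdim n)) (-1) ^+ p * \prod_b w (sg ki b) ki.1 (p b) 0.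
  rewrite /detcols -det_tr; apply: eq_bigr => p _; congr (_ * _).
  apply: eq_bigr => b _; rewrite !mxE.
  rewrite (nth_map (sg ki b)) -?cardE ?cS //.
  by rewrite {2}/sg (enum_val_nth (sg ki b)).
rewrite (eq_bigr _ (fun ki _ => E ki)) bigA_distr_bigA.
apply: eq_bigr => P _; rewrite big_split /=; congr (_ * _).
rewrite [RHS]exchange_big /=.
transitivity (\prod_k \prod_(i < n) \prod_b w (sg (k, i) b) k (P (k, i) b) 0).
  by rewrite [RHS]pair_bigA; apply: eq_bigr => -[].
apply: eq_bigr => k _.
rewrite [RHS](partition_big (fun s => c s k) predT) //=.
apply: eq_bigr => i _.
rewrite (eq_bigl (fun s => s \in slice D k i)); last by move=> s; rewrite inE.
rewrite [RHS]big_enum_val /= [RHS](reindex (cast_ord (esym (cS k i)))) /=; last first.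
  exists (cast_ord (cS k i)) => b _; [exact: cast_ordKV|exact: cast_ordK].
apply: eq_bigr => b _; rewrite !ffunE -/(sg (k, i) b).
have bS : sg (k, i) b \in slice D k i by apply: enum_valP.
have ci : c (sg (k, i) b) k = i by move: bS; rewrite inE => /eqP.
congr (w _ _ _ _).
suff -> : r (sg (k, i) b) k = b by rewrite ci.
apply: val_inj; rewrite /r /=.
move: (cP (sg (k, i) b) k); rewrite ci => bS'.
by rewrite /sg enum_valK_in.
Qed.

Lemma valL_pure (K : comNzRingType) (n : nat) (D : {set point n})
    (w : 'I_(deg D) -> 'I_3 -> 'cV[K]_(mdim n)) :
  is_diagonal D -> valL (pured (fun s => pure3 (w s))) = valH w.
Proof.
move=> hD; have [Q QE] := valHE K hD; rewrite /valL QE.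
under eq_bigr do rewrite QE mulr_sumr.
rewrite exchange_big; apply: eq_bigr => P _ /=.
rewrite (bigD1 (Q P)) //= [X in _ + X]big1 ?addr0 => [|J JQ].
  rewrite ffunE; under [X in X * _]eq_bigr do rewrite ffunE.
  rewrite mulrCA [X in _ * (_ * X)]big1 ?mulr1 // => s _.
  by rewrite big1 // => k _; rewrite mxE !eqxx.
have [s JQs] : exists s, J s != Q P s.
  apply/existsP; apply: contraNT JQ; rewrite negb_exists => /forallP h.
  by apply/eqP/ffunP => s; apply/eqP; have := h s; rewrite negbK.
have [k JQk] : exists k, J s k != Q P s k.
  apply/existsP; apply: contraNT JQs; rewrite negb_exists => /forallP h.
  by apply/eqP/ffunP => k; apply/eqP; have := h k; rewrite negbK.
rewrite (bigD1 s) //= [X in _ * (_ * (X * _))](bigD1 k) //= mxE.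
by rewrite eq_sym (negbTE JQk) /= !mul0r !mulr0.
Qed.

Lemma F_sum_pure (K : comNzRingType) (n : nat) (D : {set point n}) (r : nat)
    (t : 'I_r -> 'I_3 -> 'cV[K]_(mdim n)) :
  is_diagonal D ->
  F D (\sum_(i < r) pure3 (t i)) =
  \sum_(I : {ffun 'I_(deg D) -> 'I_r}) valH (fun s => t (I s)).
Proof.
move=> hD; under [RHS]eq_bigr do rewrite -(valL_pure _ hD).
rewrite /F /valL [RHS]exchange_big; apply: eq_bigr => J _ /=.
rewrite -mulr_suml; congr (_ * _).
rewrite [LHS]ffunE; under [LHS]eq_bigr do rewrite sum_ffunE.
by rewrite bigA_distr_bigA; apply: eq_bigr => I _; rewrite ffunE.
Qed.

(* Main.v *)
Require Import Defs.
From mathcomp Require Import all_boot all_order all_fingroup all_algebra.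
From mathcomp Require Import reals complex ring.
Import Order.TTheory GRing.Theory Num.Theory.
Local Open Scope ring_scope.

Set Implicit Arguments.
Unset Strict Implicit.
Unset Printing Implicit Defensive.

(** Write H for [HD D], d for its cardinality and m = n^2 - 1.

    Covariance is immediate: applying g_k to all the vectors of direction k
    multiplies each of the n slice determinants of that direction by det g_k,
    and [F] is a sum of such products ([valH_mulmx], [F_tact]).

    Non-vanishing is the substance.  Polarizing [F] at sums of d rank-one
    tensors made of basis vectors ([F_polarization]) reduces it to finding
    labels J_1, J_2, J_3 : H -> [m] such that the values of [valH] at the
    labelled families J o q, summed over all permutations q of H, do not cancel.
    On basis vectors the product of the slice determinants in direction k is, up
    to a constant sign, the sign of the word s |-> (J_k s, c_k s) as a bijection
    from H to [m] x [n], where c_k is the k-th coordinate ([slice_word_sign]).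
    The sum therefore equals, up to sign,

       Sum_q sgn(q) Prod_k sgn(J_k, c_k o q).

    Now exchange the roles of labels and coordinates.  For fixed J_k, the map
    f |-> sgn(J_k, f) is a product of m determinants, a relative invariant of
    GL_n of weight det^m on words f : H -> [n], and the sum above is the
    coefficient at H of the image in the d-th exterior power of
    C^n (x) C^n (x) C^n of a product of three such invariants.  As d = n^3 - n,
    that exterior power is dual to the n-th one, and it contains one relative
    invariant, supported on the complements of the diagonals.  It is obtained by
    contracting the volume form of C^(n^3), of weight det^(n^2) in each factor,
    with a determinant in its last n arguments for each of the three factors;
    this leaves weight det^m ([contract_covariant], [omega_covariant1]), and no
    cancellation occurs in the value at H ([omega_neq0]).

    It remains to see that products of determinants detect this invariant.
    This is the first fundamental theorem for SL_n, in the following form: the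
    positive semidefinite kernel
    K(f, f') = Sum_q psi(f o q) psi(f' o q), with psi a product of determinants,
    acts on all relative invariants of weight det^m by one and the same scalar,
    and this scalar is not 0 ([orbit_kernel_scalar]).  It is Cayley's Omega
    process, carried out by finite differences.  Using K in the three factors in
    turn gives labels that pair nontrivially with the invariant
    ([weight_omega]), hence with its part at some diagonal; S_n^3 permutes the
    diagonals transitively and changes everything by signs only, so that D
    itself can be taken ([weight_volume], [exists_labels]). *)

(** * Permanents and block-diagonal determinants *)

Lemma sum_injective_ffun (R : nmodType) (d : nat)
    (h : {ffun 'I_d -> 'I_d} -> R) :
  \sum_(f : {ffun 'I_d -> 'I_d} | injectiveb f) h f =
  \sum_(p : 'S_d) h (finfun p).
Proof.
rewrite (reindex (fun p : 'S_d => finfun p)) /=.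
  apply: eq_bigl => p.
  by apply/injectiveP => i j; rewrite !ffunE; apply: perm_inj.
exists (fun f : {ffun 'I_d -> 'I_d} => insubd (1%g : 'S_d) f) => [p _|f].
  have pI : injectiveb (finfun p).
    by apply/injectiveP => i j; rewrite !ffunE; apply: perm_inj.
  by apply/permP => i; rewrite -pvalE insubdK // ffunE.
rewrite inE => fI.
by apply/ffunP => i; rewrite ffunE -pvalE insubdK.
Qed.

(** Inclusion-exclusion over the set of values that are used: a function whose
    image misses some point contributes 0, so only permutations survive.  It
    serves as a substitute for extracting a multilinear coefficient, or for
    applying a differential operator, that only evaluates at points. *)
Lemma ryser_formula (R : comNzRingType) (d : nat) (l : 'I_d -> 'I_d -> R) :
  \sum_(S : {set 'I_d}) (-1) ^+ #|~: S| * \prod_t \sum_(s in S) l t s =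
  \sum_(p : 'S_d) \prod_t l t (p t).
Proof.
transitivity (\sum_(f : {ffun 'I_d -> 'I_d})
   (\prod_t l t (f t)) *
   \prod_(s < d) (1 + (if s \in codom f then 0 else -1))).
  under [RHS]eq_bigr do rewrite bigA_distr mulr_sumr.
  rewrite [RHS]exchange_big; apply: eq_bigr => S _ /=.
  under eq_bigr do rewrite big_mkcond.
  rewrite bigA_distr_bigA mulr_sumr; apply: eq_bigr => f _ /=.
  have [/forallP fS|] := boolP [forall t, f t \in S].
    rewrite mulrC; congr (_ * _).
      by apply: eq_bigr => t _; rewrite fS.
    rewrite -prodr_const big_mkcond; apply: eq_bigr => s _.
    rewrite inE; case: (boolP (s \in S)) => //= sS.
    rewrite ifN //; apply: contra sS => /codomP[t ->]; exact: fS.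
  rewrite negb_forall => /existsP[t tS].
  rewrite (bigD1 t) //= (negbTE tS) mul0r mulr0.
  by rewrite [X in _ * X](bigD1 (f t)) //= (negbTE tS) codom_f mul0r mulr0.
rewrite (bigID (fun f : {ffun 'I_d -> 'I_d} => injectiveb f)) /=.
rewrite [X in _ + X]big1 ?addr0 => [|f fI].
  rewrite sum_injective_ffun; apply: eq_bigr => p _.
  rewrite [X in _ * X]big1 ?mulr1 => [|s _].
    by apply: eq_bigr => t _; rewrite ffunE.
  case: ifPn => [_|/negP[]]; first by rewrite addr0.
  by apply/codomP; exists (p^-1 s)%g; rewrite ffunE permKV.
have [s sf] : exists s, s \notin codom f.
  apply/existsP; rewrite -negb_forall; apply: contra fI => /forallP fs.
  suff fI : {in 'I_d &, injective f} by apply/injectiveP => i j; apply: fI.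
  by apply/image_injP/eqP/eq_card => s; rewrite fs.
by rewrite [X in _ * X](bigD1 s) //= (negbTE sf) subrr mul0r mulr0.
Qed.

(** The arithmetic indexing makes [(p.+1 * q)%N] definitionally equal to
    [(q + p * q)%N], so that induction on [p] splits off one block without any
    cast. *)
Lemma det_blocks_nat (R : comNzRingType) (p q : nat)
    (B : nat -> nat -> nat -> R) :
  \det (\matrix_(s < p * q, t < p * q)
    (if (s %/ q == t %/ q)%N then B (s %/ q)%N (s %% q)%N (t %% q)%N else 0)) =
  \prod_(a < p) \det (\matrix_(i < q, j < q) B a i j).
Proof.
elim: p B => [|p IH] B; first by rewrite big_ord0 det_mx00.
case: (posnP q) => [q0|q_gt0].
  rewrite big1 => [|a _]; last by subst q; rewrite det_mx00.
  have : (p.+1 * q = 0)%N by rewrite q0 muln0.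
  by move: (p.+1 * q)%N => N N0; subst N; rewrite det_mx00.
rewrite big_ord_recl -(IH (fun a => B a.+1)).
rewrite -(det_lblock _ 0); congr (\det _).
apply/matrixP => s t; rewrite mxE -[s]splitK -[t]splitK.
case: (split s) => i; case: (split t) => j /=.
- by rewrite block_mxEul mxE !divn_small ?modn_small.
- rewrite block_mxEur mxE divn_small // divnDl ?dvdnn // divnn q_gt0.
  by rewrite add1n.
- rewrite block_mxEdl mxE (divn_small (ltn_ord j)) divnDl ?dvdnn // divnn q_gt0.
  by rewrite add1n.
- by rewrite block_mxEdr mxE !divnDl ?dvdnn // divnn q_gt0 !add1n eqSS !modnDl.
Qed.

Lemma det_blocks (R : comNzRingType) (A : finType) (q N : nat)
    (e : 'I_N -> A * 'I_q) (B : A -> 'I_q -> 'I_q -> R) :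
  bijective e ->
  \det (\matrix_(s < N, t < N)
    (if (e s).1 == (e t).1 then B (e s).1 (e s).2 (e t).2 else 0)) =
  \prod_(a : A) \det (\matrix_(i, j) B a i j).
Proof.
move=> eB; have eI := bij_inj eB.
have NE : N = (#|A| * q)%N.
  by rewrite -[LHS](card_ord N) (bij_eq_card eB) card_prod card_ord.
subst N.
(* Extension of B by 0 to natural number indices. *)
pose C a i j := \sum_(x : A | enum_rank x == a :> nat)
  \sum_(k : 'I_q | k == i :> nat) \sum_(l : 'I_q | l == j :> nat) B x k l.
have CE x (k l : 'I_q) : C (enum_rank x) k l = B x k l.
  rewrite /C (big_pred1 x) => [|y]; last first.
    by rewrite /= (inj_eq val_inj) (inj_eq enum_rank_inj).
  rewrite (big_pred1 k) => [|y]; last by rewrite /= (inj_eq val_inj).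
  by rewrite (big_pred1 l) => [|y]; last by rewrite /= (inj_eq val_inj).
have uP s : (enum_rank (e s).1 * q + (e s).2 < #|A| * q)%N.
  apply: (@leq_trans ((enum_rank (e s).1).+1 * q)); last first.
    by rewrite leq_mul2r ltn_ord orbT.
  by rewrite mulSn addnC ltn_add2r.
pose u s := Ordinal (uP s).
have q_gt0 (s : 'I_(#|A| * q)) : (0 < q)%N.
  exact: leq_ltn_trans (ltn_ord (e s).2).
have udiv s : (u s %/ q = enum_rank (e s).1)%N.
  by rewrite /= divnMDl ?(q_gt0 s) // divn_small ?addn0.
have umod s : (u s %% q = (e s).2)%N by rewrite /= modnMDl modn_small.
have uI : injective u.
  move=> s t st; apply: eI; have := udiv s; have := umod s.
  rewrite st udiv umod => /val_inj e2 /val_inj/enum_rank_inj e1.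
  by rewrite [LHS]surjective_pairing [RHS]surjective_pairing e1 e2.
have := det_blocks_nat #|A| q C.
set M := (X in \det X) => detM.
transitivity (\det (row_perm (perm uI) (col_perm (perm uI) M))).
  congr (\det _); apply/matrixP => s t.
  rewrite !mxE !permE !udiv !umod (inj_eq val_inj) (inj_eq enum_rank_inj).
  by rewrite CE.
rewrite row_permE col_permE !det_mulmx !det_perm odd_permV mulrCA -signr_addb.
rewrite addbb mulr1 detM (reindex enum_rank) /=; last first.
  by apply: onW_bij; exact: enum_rank_bij.
by apply: eq_bigr => a _; congr (\det _); apply/matrixP => i j; rewrite !mxE CE.
Qed.

(** * Signs of words *)

Lemma det_sum_rows (R : comNzRingType) (N : nat) (T : finType)
    (c : 'I_N -> T -> R) (v : 'I_N -> T -> 'I_N -> R) :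
  \det (\matrix_(s, t) \sum_i c s i * v s i t) =
  \sum_(f : {ffun 'I_N -> T})
    (\prod_s c s (f s)) * \det (\matrix_(s, t) v s (f s) t).
Proof.
rewrite /determinant; under [RHS]eq_bigr do rewrite mulr_sumr.
rewrite [RHS]exchange_big; apply: eq_bigr => p _ /=.
under eq_bigr do rewrite mxE.
rewrite bigA_distr_bigA mulr_sumr; apply: eq_bigr => f _.
rewrite big_split /= mulrCA; congr (_ * (_ * _)).
by apply: eq_bigr => s _; rewrite mxE.
Qed.

(** The sign of a word that is a bijection onto the alphabet, relative to the
    reference listing [e] of the alphabet, and 0 for the other words.  The
    definition by a determinant makes the multilinear algebra available. *)
Definition word_sign (N : nat) (T : eqType) (e w : 'I_N -> T) : int :=
  \det (\matrix_(s, t) (w s == e t)%:R).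

Section WordSign.
Variables (N : nat) (T : eqType).
Implicit Types e w : 'I_N -> T.

Lemma eq_word_sign e w w' : w =1 w' -> word_sign e w = word_sign e w'.
Proof.
by move=> ww'; congr (\det _); apply/matrixP => s t; rewrite !mxE ww'.
Qed.

Lemma word_sign_intr (R : comNzRingType) e w :
  (word_sign e w)%:~R = \det (\matrix_(s, t) (w s == e t)%:R) :> R.
Proof.
rewrite /word_sign -(det_map_mx (intr : {rmorphism int -> R})); congr (\det _).
by apply/matrixP => s t; rewrite !mxE; case: eqP.
Qed.

Lemma word_sign_perm e w (p : 'S_N) :
  word_sign e (w \o p) = (-1) ^+ p * word_sign e w.
Proof.
rewrite /word_sign -det_perm -det_mulmx -row_permE; congr (\det _).
by apply/matrixP => s t; rewrite !mxE.
Qed.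

Lemma word_sign_inj e w : word_sign e w != 0 -> injective w.
Proof.
move=> w0 s t st; apply/eqP; apply: contraNT w0 => nst; apply/eqP.
by apply: (determinant_alternate nst) => j; rewrite !mxE st.
Qed.

Lemma word_sign_ref e : injective e -> word_sign e e = 1.
Proof.
move=> eI; rewrite -(det1 _ N); congr (\det _).
by apply/matrixP => s t; rewrite !mxE (inj_eq eI).
Qed.

End WordSign.

Lemma word_sign_bij (N : nat) (T T' : eqType) (h : T -> T')
    (e w : 'I_N -> T) :
  injective h -> word_sign (h \o e) (h \o w) = word_sign e w.
Proof.
move=> hI; congr (\det _).
by apply/matrixP => s t; rewrite !mxE /= (inj_eq hI).
Qed.

(** The two listings differ by a permutation, which permutes the columns of the
    matrices of all words simultaneously; hence one sign for all words. *)
Lemma word_sign_change (N : nat) (T : eqType) (e e' : 'I_N -> T) :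
  bijective e -> injective e' ->
  exists b : bool, forall w, word_sign e' w = (-1) ^+ b * word_sign e w.
Proof.
move=> [g eg ge] e'I.
have uI : injective (g \o e') by move=> s t /(can_inj ge)/e'I.
exists (odd_perm (perm uI)) => w.
rewrite /word_sign -det_perm -[LHS]det_tr -[X in _ * X]det_tr -det_mulmx.
rewrite -row_permE; congr (\det _); apply/matrixP => s t.
by rewrite !mxE permE /= ge.
Qed.

Lemma word_sign_neq0 (N : nat) (T : eqType) (e w : 'I_N -> T) :
  injective e -> bijective w -> word_sign e w != 0.
Proof.
move=> eI wB; have [b ->] := word_sign_change wB eI.
by rewrite word_sign_ref ?mulr1 ?signr_eq0 //; apply: bij_inj.
Qed.

Lemma word_sign_letters (N : nat) (T : eqType) (e : 'I_N -> T) (h : T -> T) :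
  bijective e -> injective h ->
  exists b : bool, forall w, word_sign e (h \o w) = (-1) ^+ b * word_sign e w.
Proof.
move=> eB hI.
have [b bE] : exists b : bool, forall w,
    word_sign (h \o e) w = (-1) ^+ b * word_sign e w.
  by apply: word_sign_change => //; apply: inj_comp => //; apply: bij_inj.
exists b => w; rewrite -(word_sign_bij e w hI) bE mulrA -signr_addb addbb.
by rewrite mul1r.
Qed.

(** * Relative invariants of GL_n on words *)

(** A function [x] on words holds the coefficients of a multilinear form in [d]
    vectors of dimension [n]; the condition says that this form is a relative
    invariant of weight [det ^ k].  The coefficients are integers but [g] ranges
    over matrices with entries in [R], since polynomial entries are needed in
    order to divide by [\det g]. *)
Definition covariant (R : comNzRingType) (d n k : nat)
    (x : {ffun 'I_d -> 'I_n} -> int) :=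
  forall (g : 'M[R]_n) (f : {ffun 'I_d -> 'I_n}),
  \sum_(f' : {ffun 'I_d -> 'I_n}) (\prod_s g (f s) (f' s)) * (x f')%:~R =
  (\det g) ^+ k * (x f)%:~R.

(** In words (J, f) over [A * 'I_n], letting g act on the second component
    multiplies the matrix of the word by the block-diagonal matrix with #|A|
    blocks g. *)
Lemma word_sign_covariant (R : comNzRingType) (A : finType) (n N : nat)
    (e : 'I_N -> A * 'I_n) (J : 'I_N -> A) :
  bijective e ->
  covariant R #|A|
    (fun f : {ffun 'I_N -> 'I_n} => word_sign e (fun s => (J s, f s))).
Proof.
move=> eB g f; have [e' ee' e'e] := eB.
have -> : (\det g) ^+ #|A| = \det (\matrix_(s < N, t < N)
    (if (e s).1 == (e t).1 then g (e s).2 (e t).2 else 0)).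
  rewrite (det_blocks (fun _ i j => g i j)) // prodr_const; congr (_ ^+ _).
  by congr (\det _); apply/matrixP => i j; rewrite mxE.
under eq_bigr do rewrite word_sign_intr.
rewrite -(det_sum_rows (fun s i => g (f s) i)
  (fun s i t => ((J s, i) == e t)%:R)).
rewrite word_sign_intr mulrC -det_mulmx; congr (\det _).
apply/matrixP => s t; rewrite !mxE (bigD1 (e' (J s, f s))) //= !mxE e'e eqxx.
rewrite [X in _ + X]big1 ?addr0 => [|r rs]; last first.
  by rewrite !mxE -[_ == e r](can2_eq e'e ee') eq_sym (negbTE rs) mul0r.
rewrite mul1r /=; case: eqP => [Jt|Jt]; last first.
  rewrite big1 // => i _; case: eqP => [et|]; last by rewrite mulr0.
  by case: Jt; rewrite -et.
rewrite (bigD1 (e t).2) //= Jt -surjective_pairing eqxx mulr1 big1 ?addr0 //.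
move=> i it; case: eqP => [et|]; last by rewrite mulr0.
by move: it; rewrite -et eqxx.
Qed.

Lemma covariant_sum (R : comNzRingType) (d n k : nat) (I : finType)
    (c : I -> int) (x : I -> {ffun 'I_d -> 'I_n} -> int) :
  (forall i, covariant R k (x i)) ->
  covariant R k (fun f => \sum_i c i * x i f).
Proof.
move=> xC g f; rewrite rmorph_sum mulr_sumr /=.
under eq_bigr do rewrite rmorph_sum mulr_sumr.
rewrite exchange_big; apply: eq_bigr => i _ /=.
rewrite rmorphM mulrCA -xC mulr_sumr; apply: eq_bigr => f' _.
by rewrite rmorphM mulrCA.
Qed.

(** * Contraction with a determinant *)

Definition cat_word (d n : nat) (T : Type) (f : 'I_d -> T) (a : 'I_n -> T) :
    'I_(d + n) -> T :=
  fun s => match split s with inl i => f i | inr j => a j end.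

Lemma cat_word_lshift (d n : nat) (T : Type) (f : 'I_d -> T) (a : 'I_n -> T) s :
  cat_word f a (lshift n s) = f s.
Proof. by rewrite /cat_word -[lshift n s]/(unsplit (inl s)) unsplitK. Qed.

Lemma cat_word_rshift (d n : nat) (T : Type) (f : 'I_d -> T) (a : 'I_n -> T) i :
  cat_word f a (rshift d i) = a i.
Proof. by rewrite /cat_word -[rshift d i]/(unsplit (inr i)) unsplitK. Qed.

Lemma sum_cat_word (R : nmodType) (d n : nat) (T : finType)
    (F : {ffun 'I_(d + n) -> T} -> R) :
  \sum_h F h = \sum_(f : {ffun 'I_d -> T}) \sum_(a : {ffun 'I_n -> T})
    F (finfun (cat_word f a)).
Proof.
rewrite pair_bigA /= (reindex (fun p : {ffun 'I_d -> T} * {ffun 'I_n -> T} =>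
  finfun (cat_word p.1 p.2))) //=.
exists (fun h : {ffun 'I_(d + n) -> T} =>
  (finfun (h \o @lshift d n), finfun (h \o @rshift d n))) => [[f a] _|h _].
  by congr pair; apply/ffunP => s; rewrite !ffunE /= ffunE;
    rewrite ?cat_word_lshift ?cat_word_rshift.
apply/ffunP => s; rewrite ffunE -[s]splitK; case: (split s) => i /=;
by rewrite ?cat_word_lshift ?cat_word_rshift ffunE.
Qed.

Definition contract (d n : nat) (x : {ffun 'I_(d + n) -> 'I_n} -> int)
    (f : {ffun 'I_d -> 'I_n}) : int :=
  \sum_(a : {ffun 'I_n -> 'I_n}) word_sign id a * x (finfun (cat_word f a)).

(** The determinant as a function on words of length n is invariant, up to
    [\det g], under the transposed action as well. *)
Lemma word_sign_dual (R : comNzRingType) (n : nat) (g : 'M[R]_n)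
    (a : {ffun 'I_n -> 'I_n}) :
  \det g * (word_sign id a)%:~R =
  \sum_(b : {ffun 'I_n -> 'I_n})
    (\prod_i g (b i) (a i)) * (word_sign id b)%:~R.
Proof.
under eq_bigr do rewrite word_sign_intr.
rewrite -(det_sum_rows (fun i b => g b (a i)) (fun i b j => (b == j)%:R)).
rewrite word_sign_intr mulrC -[in LHS](det_tr g) -det_mulmx; congr (\det _).
apply/matrixP => i j; rewrite !mxE (bigD1 (a i)) //= !mxE eqxx mul1r.
rewrite [RHS](bigD1 j) //= eqxx mulr1 !big1 // => k.
  by move=> /negbTE ->; rewrite mulr0.
by rewrite !mxE eq_sym => /negbTE ->; rewrite mul0r.
Qed.

(** Multiplying by [\det g] and absorbing this factor in the contracting
    determinant lets g act on all d + n letters; so the contraction has the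
    weight of [x] lowered by one, after cancellation of [\det g]. *)
Lemma contract_covariant_regular (R : idomainType) (d n k : nat)
    (x : {ffun 'I_(d + n) -> 'I_n} -> int) (g : 'M[R]_n)
    (f : {ffun 'I_d -> 'I_n}) :
  covariant R k.+1 x -> \det g != 0 ->
  \sum_(f' : {ffun 'I_d -> 'I_n})
    (\prod_s g (f s) (f' s)) * (contract x f')%:~R =
  (\det g) ^+ k * (contract x f)%:~R.
Proof.
move=> xC g0; apply: (mulfI g0).
transitivity (\sum_(b : {ffun 'I_n -> 'I_n}) (word_sign id b)%:~R *
  \sum_(h : {ffun 'I_(d + n) -> 'I_n})
    (\prod_s g (finfun (cat_word f b) s) (h s)) * (x h)%:~R); last first.
  under eq_bigr do rewrite xC mulrCA.
  rewrite -mulr_sumr mulrA -exprS; congr (_ * _).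
  by rewrite rmorph_sum; apply: eq_bigr => b _; rewrite rmorphM.
under [RHS]eq_bigr do rewrite sum_cat_word mulr_sumr.
rewrite [RHS]exchange_big mulr_sumr; apply: eq_bigr => f' _ /=.
under [RHS]eq_bigr do rewrite mulr_sumr.
rewrite [RHS]exchange_big rmorph_sum !mulr_sumr; apply: eq_bigr => a _ /=.
rewrite rmorphM mulrCA [X in _ * X]mulrA word_sign_dual mulr_suml mulr_sumr.
apply: eq_bigr => b _; rewrite big_split_ord /=.
under [X in _ = _ * (X * _ * _)]eq_bigr do
  rewrite !ffunE !cat_word_lshift.
under [X in _ = _ * (_ * X * _)]eq_bigr do
  rewrite !ffunE !cat_word_rshift.
by ring.
Qed.

(** For singular [g] the previous argument applies to ['X + g] over the
    polynomials, whose determinant is the characteristic polynomial of [- g],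
    and one then sets ['X] to 0. *)
Lemma contract_covariant (d n k : nat)
    (x : {ffun 'I_(d + n) -> 'I_n} -> int) :
  covariant {poly int} k.+1 x -> covariant int k (contract x).
Proof.
move=> xC g f.
pose G : 'M[{poly int}]_n := 'X%:M - map_mx polyC (- g).
have G0 : \det G != 0 by rewrite -/(char_poly _) monic_neq0 ?char_poly_monic.
have /(congr1 (horner_eval (0 : int))) := contract_covariant_regular f xC G0.
have Gg : map_mx (horner_eval (0 : int)) G = g.
  apply/matrixP => i j; rewrite !mxE /horner_eval !hornerE hornerMn hornerX.
  by rewrite mul0rn sub0r opprK.
rewrite rmorph_sum rmorphM rmorphXn -det_map_mx Gg /= rmorph_int => <-.
apply: eq_bigr => f' _; rewrite rmorphM rmorph_prod rmorph_int; congr (_ * _).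
by apply: eq_bigr => s _; rewrite -[in LHS]Gg mxE.
Qed.

(** * The Omega process *)

Definition orbit_kernel (d n : nat) (psi : {ffun 'I_d -> 'I_n} -> int)
    (f f' : {ffun 'I_d -> 'I_n}) : int :=
  \sum_(p : 'S_d) psi [ffun s => f (p s)] * psi [ffun s => f' (p s)].

(** Let Omega(p) be the contraction of the full polarization of a polynomial p
    in the entries of g with [psi] (x) [psi].  Applied to the monomial
    Prod_s g (f s) (f' s) it gives [orbit_kernel psi f f'], so applying it to
    the equation that defines the covariance of [x] gives the claim, with
    c = Omega(det ^ k) independent of [x].  For x = psi the claim shows that
    c * |psi|^2 is a sum of squares, one of which is |psi|^4 > 0. *)
Lemma orbit_kernel_scalar (d n k : nat) (psi : {ffun 'I_d -> 'I_n} -> int)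
    (f0 : {ffun 'I_d -> 'I_n}) :
  covariant int k psi -> psi f0 != 0 ->
  exists2 c : int, c != 0 & forall x, covariant int k x -> forall f,
    \sum_f' orbit_kernel psi f f' * x f' = c * x f.
Proof.
move=> psiC psi0; pose W := {ffun 'I_d -> 'I_n}.
(* M S u u' is the sum over s in S of the elementary matrices at (u s, u' s):
   these are the points at which Ryser's formula evaluates det ^ k. *)
pose M (S : {set 'I_d}) (u u' : {ffun 'I_d -> 'I_n}) : 'M[int]_n :=
  \matrix_(i, j) \sum_(s in S) ((i == u s) && (j == u' s))%:R.
pose c := \sum_u \sum_u' psi u * psi u' *
  \sum_(S : {set 'I_d}) (-1) ^+ #|~: S| * (\det (M S u u')) ^+ k.
have cE x : covariant int k x -> forall f,
    \sum_f' orbit_kernel psi f f' * x f' = c * x f.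
  move=> xC f.
  transitivity (\sum_(f' : W) (\sum_u \sum_u' psi u * psi u' *
      \sum_(p : 'S_d) \prod_t ((f t == u (p t)) && (f' t == u' (p t)))%:R) *
      x f').
    apply: eq_bigr => f' _; congr (_ * _); rewrite /orbit_kernel.
    under [RHS]eq_bigr => u _ do under eq_bigr => u' _ do rewrite mulr_sumr.
    under [RHS]eq_bigr => u _ do rewrite exchange_big /=.
    rewrite [RHS]exchange_big (reindex_inj invg_inj) /=.
    apply: eq_bigr => p _; set v := finfun _; set v' := finfun _.
    have P (u u' : W) : \prod_t ((f t == u (p t)) && (f' t == u' (p t)))%:R
        = ((u == v) && (u' == v'))%:R :> int.
      have [/andP[/eqP-> /eqP->]|ne] := boolP (_ && _).
        by rewrite big1 // => t _; rewrite !ffunE permK !eqxx.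
      have [t /negbTE tN] :
          exists t, ~~ ((f t == u (p t)) && (f' t == u' (p t))).
        apply/existsP; rewrite -negb_forall; apply: contra ne => /forallP h.
        by apply/andP; split; apply/eqP/ffunP => s; rewrite ffunE;
          have /andP[/eqP h1 /eqP h2] := h ((p^-1)%g s);
          rewrite ?h1 ?h2 permKV.
      by rewrite (bigD1 t) //= tN mul0r.
    rewrite (bigD1 v) //= (bigD1 v') //= P !eqxx mulr1 !big1 ?addr0 //.
      by move=> u /negbTE uv; rewrite big1 // => u' _; rewrite P uv mulr0.
    by move=> u' /negbTE uv; rewrite P uv andbF mulr0.
  rewrite /c [RHS]mulr_suml; under [LHS]eq_bigr do rewrite mulr_suml.
  rewrite [LHS]exchange_big; apply: eq_bigr => u _ /=; rewrite [RHS]mulr_suml.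
  under [LHS]eq_bigr do rewrite mulr_suml.
  rewrite [LHS]exchange_big; apply: eq_bigr => u' _ /=.
  under [LHS]eq_bigr => f' _ do
    rewrite -mulrA -(ryser_formula
      (fun t s => ((f t == u s) && (f' t == u' s))%:R)).
  rewrite -mulr_sumr -[RHS]mulrA; congr (_ * _).
  rewrite [RHS]mulr_suml; under [LHS]eq_bigr do rewrite mulr_suml.
  rewrite [LHS]exchange_big; apply: eq_bigr => S _ /=.
  rewrite -mulrA -[x f]intz -xC mulr_sumr; apply: eq_bigr => f' _.
  rewrite -mulrA intz; congr (_ * (_ * _)).
  by apply: eq_bigr => t _; rewrite mxE.
exists c => //.
pose nrm := \sum_f psi f ^+ 2.
have nrm_gt0 : 0 < nrm.
  rewrite /nrm (bigD1 f0) //=; apply: ltr_pwDl; last first.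
    by apply: sumr_ge0 => f _; exact: sqr_ge0.
  by rewrite exprn_even_gt0.
have cn : c * nrm =
    \sum_(p : 'S_d) (\sum_(f : W) psi [ffun s => f (p s)] * psi f) ^+ 2.
  transitivity (\sum_f psi f * (c * psi f)).
    by rewrite /nrm mulr_sumr; apply: eq_bigr => f _; rewrite expr2 mulrCA.
  under [LHS]eq_bigr do rewrite -(cE _ psiC) mulr_sumr /orbit_kernel.
  under [LHS]eq_bigr => f _ do under eq_bigr do rewrite mulr_suml mulr_sumr.
  under [LHS]eq_bigr => f _ do rewrite exchange_big /=.
  rewrite [LHS]exchange_big; apply: eq_bigr => p _ /=.
  rewrite expr2 mulr_suml; apply: eq_bigr => f _; rewrite mulr_sumr.
  by apply: eq_bigr => f' _; ring.
suff : 0 < c * nrm by apply: contraTneq => ->; rewrite mul0r ltxx.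
rewrite cn (bigD1 1%g) //=; apply: ltr_pwDl; last first.
  by apply: sumr_ge0 => p _; exact: sqr_ge0.
rewrite exprn_even_gt0 //= gt_eqF //.
rewrite [X in _ < X](_ : _ = nrm) //; apply: eq_bigr => f _.
by rewrite expr2; congr (psi _ * _); apply/ffunP => s; rewrite ffunE perm1.
Qed.

(** * The invariant supported on complements of diagonals *)

Lemma word_sign_cat (d n : nat) (T : eqType) (e : 'I_(d + n) -> T)
    (f : 'I_d -> T) (a : 'I_n -> T) (q : 'S_d) (r : 'S_n) :
  word_sign e (cat_word (f \o q) (a \o r)) =
  (-1) ^+ q * (-1) ^+ r * word_sign e (cat_word f a).
Proof.
rewrite /word_sign; set M := (X in _ = _ * \det X).
rewrite -!det_perm -(det_lblock _ 0) -det_mulmx -[M]vsubmxK mul_block_col.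
rewrite !mul0mx addr0 add0r -!row_permE; congr (\det _).
apply/matrixP => s t; rewrite mxE -[s]splitK; case: (split s) => i /=.
  by rewrite col_mxEu !mxE !cat_word_lshift.
by rewrite col_mxEd !mxE !cat_word_rshift.
Qed.

(** Both [f] and [g] enumerate the complement of the image of [a]. *)
Lemma cat_word_left (d n : nat) (T : finType) (f g : 'I_d -> T)
    (a : 'I_n -> T) :
  bijective (cat_word f a) -> injective (cat_word g a) ->
  exists q : 'S_d, g =1 f \o q.
Proof.
move=> [w fw wf] gI.
have wl s : exists t, w (g s) == lshift n t.
  have := wf (g s); rewrite -[w _]splitK; case: (split _) => [t _|i].
    by exists t.
  rewrite /= cat_word_rshift -(cat_word_rshift g) -(cat_word_lshift g a).
  by move=> /gI/eqP; rewrite eq_sym eq_lrshift.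
have E s : f (xchoose (wl s)) = g s.
  by rewrite -(cat_word_lshift f a) -(eqP (xchooseP (wl s))) wf.
have qI : injective (fun s => xchoose (wl s)).
  move=> s t /(congr1 f); rewrite !E -!(cat_word_lshift g a) => /gI.
  exact: lshift_inj.
by exists (perm qI) => s; rewrite /= permE E.
Qed.

Lemma cat_word_right (d n : nat) (T : finType) (f : 'I_d -> T)
    (a b : 'I_n -> T) :
  bijective (cat_word f a) -> injective (cat_word f b) ->
  exists r : 'S_n, b =1 a \o r.
Proof.
move=> [w fw wf] bI.
have wr s : exists t, w (b s) == rshift d t.
  have := wf (b s); rewrite -[w _]splitK; case: (split _) => [i|t _].
    rewrite /= cat_word_lshift -(cat_word_lshift f b) -(cat_word_rshift f b).
    by move=> /bI/eqP; rewrite eq_lrshift.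
  by exists t.
have E s : a (xchoose (wr s)) = b s.
  by rewrite -(cat_word_rshift f a) -(eqP (xchooseP (wr s))) wf.
have rI : injective (fun s => xchoose (wr s)).
  move=> s t /(congr1 a); rewrite !E -!(cat_word_rshift f b) => /bI.
  exact: rshift_inj.
by exists (perm rI) => s; rewrite /= permE E.
Qed.

Definition triple (N n : nat) (w1 w2 w3 : 'I_N -> 'I_n) :
    'I_N -> 'I_n * 'I_n * 'I_n := fun s => (w1 s, w2 s, w3 s).

Lemma eq_covariant (R : comNzRingType) (d n k : nat)
    (x y : {ffun 'I_d -> 'I_n} -> int) :
  x =1 y -> covariant R k x -> covariant R k y.
Proof.
by move=> xy xC g f; rewrite -xy -xC; apply: eq_bigr => f' _; rewrite xy.
Qed.

Section Contraction.
Variables (d n m : nat) (e : 'I_(d + n) -> 'I_n * 'I_n * 'I_n).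
Hypotheses (eB : bijective e) (nm : (n * n)%N = m.+1).
Local Notation W := {ffun 'I_d -> 'I_n}.
Local Notation V := {ffun 'I_n -> 'I_n}.
Implicit Types (f : W) (a : V).

Definition volume f1 f2 f3 a1 a2 a3 : int :=
  word_sign e (cat_word (triple f1 f2 f3) (triple a1 a2 a3)).

(** The invariant of weight [det ^ m] in each factor: [volume] is the volume
    form on the tensor product of three copies of the n-dimensional space, and
    the contractions antisymmetrize its last n arguments in each factor. *)
Definition omega f1 f2 f3 : int :=
  \sum_(a1 : V) \sum_(a2 : V) \sum_(a3 : V)
    word_sign id a1 * word_sign id a2 * word_sign id a3 *
    volume f1 f2 f3 a1 a2 a3.

Lemma volumeE f1 f2 f3 a1 a2 a3 :
  volume f1 f2 f3 a1 a2 a3 = word_sign e (triple (finfun (cat_word f1 a1))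
    (finfun (cat_word f2 a2)) (finfun (cat_word f3 a3))).
Proof.
apply: eq_word_sign => s; rewrite /triple !ffunE -[s]splitK.
by case: (split s) => i /=; rewrite ?cat_word_lshift ?cat_word_rshift.
Qed.

(** In one factor, [omega] is a combination of contractions of the volume form,
    whose weight there is [det ^ (n * n)]. *)
Lemma omega_covariant1 f2 f3 : covariant int m (fun f => omega f f2 f3).
Proof.
apply: (@eq_covariant _ _ _ _ (fun f : W => \sum_(b : V * V)
    (word_sign id b.1 * word_sign id b.2) * contract
      (fun h : {ffun 'I_(d + n) -> 'I_n} => word_sign e (triple h
        (finfun (cat_word f2 b.1)) (finfun (cat_word f3 b.2)))) f)).
  move=> f; rewrite /omega; under [LHS]eq_bigr do rewrite mulr_sumr.
  rewrite [LHS]exchange_big; apply: eq_bigr => a1 _ /=; rewrite [RHS]pair_bigA.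
  by apply: eq_bigr => -[a2 a3] _; rewrite volumeE /=; ring.
apply: covariant_sum => -[a2 a3]; apply: contract_covariant => /=.
rewrite -nm -[(n * n)%N](_ : #|{: 'I_n * 'I_n}| = _); last first.
  by rewrite card_prod card_ord.
pose h (t : 'I_n * 'I_n * 'I_n) := (t.1.2, t.2, t.1.1).
have hB : bijective h.
  by exists (fun t : 'I_n * 'I_n * 'I_n => (t.2, t.1.1, t.1.2)) => -[[]].
have := @word_sign_covariant {poly int} _ _ _ (h \o e) (fun s =>
  (finfun (cat_word f2 a2) s, finfun (cat_word f3 a3) s)) (bij_comp hB eB).
by apply: eq_covariant => w; rewrite -(word_sign_bij e _ (bij_inj hB)).
Qed.

Lemma omega_covariant2 f1 f3 : covariant int m (fun f => omega f1 f f3).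
Proof.
apply: (@eq_covariant _ _ _ _ (fun f : W => \sum_(b : V * V)
    (word_sign id b.1 * word_sign id b.2) * contract
      (fun h : {ffun 'I_(d + n) -> 'I_n} => word_sign e (triple
        (finfun (cat_word f1 b.1)) h (finfun (cat_word f3 b.2)))) f)).
  move=> f; rewrite /omega; under [RHS]eq_bigr do rewrite exchange_big /=.
  rewrite [RHS]pair_bigA; apply: eq_bigr => -[a1 a3] _ /=.
  by rewrite [LHS]mulr_sumr; apply: eq_bigr => a2 _; rewrite volumeE /=; ring.
apply: covariant_sum => -[a1 a3]; apply: contract_covariant => /=.
rewrite -nm -[(n * n)%N](_ : #|{: 'I_n * 'I_n}| = _); last first.
  by rewrite card_prod card_ord.
pose h (t : 'I_n * 'I_n * 'I_n) := (t.1.1, t.2, t.1.2).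
have hB : bijective h.
  by exists (fun t : 'I_n * 'I_n * 'I_n => (t.1.1, t.2, t.1.2)) => -[[]].
have := @word_sign_covariant {poly int} _ _ _ (h \o e) (fun s =>
  (finfun (cat_word f1 a1) s, finfun (cat_word f3 a3) s)) (bij_comp hB eB).
by apply: eq_covariant => w; rewrite -(word_sign_bij e _ (bij_inj hB)).
Qed.

Lemma omega_covariant3 f1 f2 : covariant int m (fun f => omega f1 f2 f).
Proof.
apply: (@eq_covariant _ _ _ _ (fun f : W => \sum_(b : V * V)
    (word_sign id b.1 * word_sign id b.2) * contract
      (fun h : {ffun 'I_(d + n) -> 'I_n} => word_sign e (triple
        (finfun (cat_word f1 b.1)) (finfun (cat_word f2 b.2)) h)) f)).
  move=> f; rewrite /omega pair_bigA; apply: eq_bigr => -[a1 a2] _ /=.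
  by rewrite mulr_sumr; apply: eq_bigr => a3 _; rewrite volumeE /=; ring.
apply: covariant_sum => -[a1 a2]; apply: contract_covariant => /=.
rewrite -nm -[(n * n)%N](_ : #|{: 'I_n * 'I_n}| = _); last first.
  by rewrite card_prod card_ord.
exact: (@word_sign_covariant {poly int} _ _ _ e (fun s =>
  (finfun (cat_word f1 a1) s, finfun (cat_word f2 a2) s))).
Qed.

(** All nonzero terms of the sum have the same sign.  Such a term comes from
    words b_k which enumerate the same set of triples as the a_k, so that
    b_k = a_k o r for a single permutation r; this r contributes its sign once
    for each factor and once in the volume form, four times in all. *)
Lemma omega_neq0 f1 f2 f3 a1 a2 a3 :
  injective a1 -> injective a2 -> injective a3 ->
  bijective (cat_word (triple f1 f2 f3) (triple a1 a2 a3)) ->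
  omega f1 f2 f3 != 0.
Proof.
move=> a1I a2I a3I fB.
pose C := word_sign id a1 * word_sign id a2 * word_sign id a3 *
          volume f1 f2 f3 a1 a2 a3.
have C0 : C != 0.
  rewrite !mulf_neq0 ?(word_sign_neq0 _ (injF_bij _)) //.
  exact: word_sign_neq0 (bij_inj eB) fB.
have term (b1 b2 b3 : V) : 0 <= C * (word_sign id b1 * word_sign id b2 *
    word_sign id b3 * volume f1 f2 f3 b1 b2 b3).
  have [->|v0] := eqVneq (volume f1 f2 f3 b1 b2 b3) 0; first by rewrite !mulr0.
  have [r rE] := cat_word_right fB (word_sign_inj v0).
  suff -> : word_sign id b1 * word_sign id b2 * word_sign id b3 *
    volume f1 f2 f3 b1 b2 b3 = C by rewrite -expr2 sqr_ge0.
  rewrite (@eq_word_sign _ _ id b1 (a1 \o r)); last by move=> s; case: (rE s).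
  rewrite (@eq_word_sign _ _ id b2 (a2 \o r)); last by move=> s; case: (rE s).
  rewrite (@eq_word_sign _ _ id b3 (a3 \o r)); last by move=> s; case: (rE s).
  rewrite {1}/volume (@eq_word_sign _ _ e _
    (cat_word (triple f1 f2 f3 \o (1%g : 'S_d)) (triple a1 a2 a3 \o r)));
    last first.
    by move=> s; rewrite /cat_word; case: split => i; rewrite ?rE //= perm1.
  rewrite word_sign_cat odd_perm1 !word_sign_perm /C /volume.
  by case: (odd_perm r) => /=; ring.
suff : 0 < C * omega f1 f2 f3 by apply: contraTneq => ->; rewrite mulr0 ltxx.
rewrite /omega mulr_sumr (bigD1 a1) //=; apply: ltr_pwDl; last first.
  apply: sumr_ge0 => b1 _; rewrite mulr_sumr; apply: sumr_ge0 => b2 _.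
  by rewrite mulr_sumr; apply: sumr_ge0 => b3 _.
rewrite mulr_sumr (bigD1 a2) //=; apply: ltr_pwDl; last first.
  by apply: sumr_ge0 => b2 _; rewrite mulr_sumr; apply: sumr_ge0 => b3 _.
rewrite mulr_sumr (bigD1 a3) //=; apply: ltr_pwDl; last first.
  exact: sumr_ge0.
by rewrite -expr2 exprn_even_gt0.
Qed.
End Contraction.

(** * Existence of labels *)

Lemma sum_neq0 (R : nmodType) (I : finType) (F : I -> R) :
  \sum_i F i != 0 -> exists i, F i != 0.
Proof.
move=> F0; apply/existsP; apply: contraNT F0.
rewrite negb_exists => /forallP F0.
by rewrite big1 // => i _; apply/eqP; rewrite -[_ == _]negbK.
Qed.

(** A relative invariant is detected by the permuted copies of a single one, as
    the kernel built from these copies acts on it by a nonzero scalar. *)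
Lemma covariant_twist (d n k : nat) (psi x : {ffun 'I_d -> 'I_n} -> int)
    (f0 f : {ffun 'I_d -> 'I_n}) :
  covariant int k psi -> psi f0 != 0 -> covariant int k x -> x f != 0 ->
  exists q : 'S_d,
    \sum_(g : {ffun 'I_d -> 'I_n}) psi [ffun s => g (q s)] * x g != 0.
Proof.
move=> psiC psi0 xC xf; have [c c0 cE] := orbit_kernel_scalar psiC psi0.
have : \sum_g orbit_kernel psi f g * x g != 0 by rewrite cE // mulf_neq0.
under eq_bigr do rewrite mulr_suml.
rewrite exchange_big => /sum_neq0[q /= q0]; exists q.
apply: contraNneq q0 => q0; under eq_bigr do rewrite -mulrA.
by rewrite -mulr_sumr q0 mulr0.
Qed.

Section Labels.
Variables (d n m : nat) (e : 'I_(d + n) -> 'I_n * 'I_n * 'I_n).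
Variable (es : 'I_d -> 'I_m * 'I_n).
Hypotheses (eB : bijective e) (esB : bijective es) (nm : (n * n)%N = m.+1).
Local Notation W := {ffun 'I_d -> 'I_n}.
Local Notation V := {ffun 'I_n -> 'I_n}.

(** When the labels [J] are fixed and each occurs n times, this is up to sign a
    product, over all labels, of the determinants of the coordinates at the
    positions carrying that label; when the coordinates [f] are fixed and each
    occurs m times, it is a product of slice determinants. *)
Definition label_sign (J : 'I_d -> 'I_m) (f : 'I_d -> 'I_n) : int :=
  word_sign es (fun s => (J s, f s)).

(** The labelling by the first component of [es], each label occurring n times;
    every other balanced labelling is a permutation of it. *)
Let psi (f : W) : int := label_sign (fun s => (es s).1) f.

Lemma label_sign_perm J f (q : 'S_d) :
  label_sign (J \o q) (f \o q) = (-1) ^+ q * label_sign J f.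
Proof. exact: (word_sign_perm es (fun s => (J s, f s)) q). Qed.

Lemma label_sign_letters (v : 'S_n) :
  exists b : bool, forall J f,
    label_sign J (v \o f) = (-1) ^+ b * label_sign J f.
Proof.
have vI : injective (fun t : 'I_m * 'I_n => (t.1, v t.2)).
  by move=> [a i] [b j] [-> /perm_inj ->].
have [b bE] := word_sign_letters esB vI.
by exists b => J f; apply: (bE (fun s => (J s, f s))).
Qed.

Lemma psi_covariant : covariant int m psi.
Proof.
have := word_sign_covariant (R := int) (fun s => (es s).1) esB.
by rewrite card_ord.
Qed.

Lemma psi_neq0 : psi [ffun s => (es s).2] != 0.
Proof.
rewrite /psi /label_sign (@eq_word_sign _ _ es _ es).
  by rewrite word_sign_ref ?oner_eq0 //; apply: bij_inj.
by move=> s; rewrite ffunE -surjective_pairing.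
Qed.

Let weight (q1 q2 q3 : 'S_d) (u : W * W * W) : int :=
  psi [ffun s => u.1.1 (q1 s)] * psi [ffun s => u.1.2 (q2 s)] *
  psi [ffun s => u.2 (q3 s)].

(** Summing a covariant function of several words against fixed weights in some
    of them keeps it covariant in the others, so that the factors can be treated
    one after the other. *)
Lemma weight_omega (f1 f2 f3 : W) :
  omega e f1 f2 f3 != 0 ->
  exists q1 q2 q3, \sum_u weight q1 q2 q3 u * omega e u.1.1 u.1.2 u.2 != 0.
Proof.
move=> w0.
have [q1 w1] := covariant_twist psi_covariant psi_neq0
  (omega_covariant1 eB nm f2 f3) w0.
have [q2 w2] := covariant_twist psi_covariant psi_neq0
  (covariant_sum (fun g1 : W => psi [ffun s => g1 (q1 s)])
    (fun g1 : W => omega_covariant2 eB nm g1 f3)) w1.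
have [q3 w3] := covariant_twist psi_covariant psi_neq0
  (covariant_sum (fun g2 : W => psi [ffun s => g2 (q2 s)]) (fun g2 : W =>
    covariant_sum (fun g1 : W => psi [ffun s => g1 (q1 s)])
      (fun g1 : W => omega_covariant3 eB nm g1 g2))) w2.
exists q1, q2, q3; apply: contraNneq w3 => E; apply/eqP; rewrite -[RHS]E.
rewrite -(pair_bigA _ (fun a c =>
  weight q1 q2 q3 (a, c) * omega e a.1 a.2 c)) /=.
rewrite [RHS]exchange_big; apply: eq_bigr => g3 _ /=.
rewrite -(pair_bigA _ (fun a c =>
  weight q1 q2 q3 (a, c, g3) * omega e a c g3)) /=.
rewrite [RHS]exchange_big mulr_sumr; apply: eq_bigr => g2 _ /=.
rewrite mulrA mulr_sumr; apply: eq_bigr => g1 _.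
by rewrite /weight /=; ring.
Qed.

(** Some term b of the sum defining [omega] pairs nontrivially with the weights.
    The permutations v_k with p_k = v_k o b_k, applied to the letters of all
    words, transform this term into the one of p, and change the weights and the
    volume form by signs that do not depend on the words. *)
Lemma weight_volume (f1 f2 f3 : W) (p1 p2 p3 : V) :
  injective p1 -> injective p2 -> injective p3 ->
  bijective (cat_word (triple f1 f2 f3) (triple p1 p2 p3)) ->
  exists q1 q2 q3,
    \sum_u weight q1 q2 q3 u * volume e u.1.1 u.1.2 u.2 p1 p2 p3 != 0.
Proof.
move=> p1I p2I p3I /(omega_neq0 eB p1I p2I p3I)/weight_omega[q1 [q2 [q3]]].
rewrite /omega; under eq_bigr do rewrite mulr_sumr.
rewrite exchange_big => /sum_neq0[b1 /=]; under eq_bigr do rewrite mulr_sumr.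
rewrite exchange_big => /sum_neq0[b2 /=]; under eq_bigr do rewrite mulr_sumr.
rewrite exchange_big => /sum_neq0[b3 /=].
under eq_bigr do rewrite mulrCA; rewrite -mulr_sumr.
rewrite !mulf_eq0 !negb_or -!andbA => /and4P[].
move=> /word_sign_inj b1I /word_sign_inj b2I /word_sign_inj b3I u0.
exists q1, q2, q3.
pose v1 := ((perm b1I)^-1 * perm p1I)%g.
pose v2 := ((perm b2I)^-1 * perm p2I)%g.
pose v3 := ((perm b3I)^-1 * perm p3I)%g.
have E (b p : V) (bI : injective b) (pI : injective p) i :
    ((perm bI)^-1 * perm pI)%g (b i) = p i.
  by rewrite permM -[b i](permE bI) permK permE.
pose h (t : 'I_n * 'I_n * 'I_n) := (v1 t.1.1, v2 t.1.2, v3 t.2).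
have hI : injective h.
  by move=> [[i j] k] [[i' j'] k'] [/perm_inj -> /perm_inj -> /perm_inj ->].
have [c cE] := word_sign_letters eB hI.
have [c1 c1E] := label_sign_letters v1.
have [c2 c2E] := label_sign_letters v2.
have [c3 c3E] := label_sign_letters v3.
pose H (u : W * W * W) : W * W * W :=
  ([ffun s => v1 (u.1.1 s)], [ffun s => v2 (u.1.2 s)], [ffun s => v3 (u.2 s)]).
have HI : injective H.
  move=> [[u1 u2] u3] [[w1 w2] w3] [/ffunP E1 /ffunP E2 /ffunP E3].
  by congr (_, _, _); apply/ffunP => s;
    [have := E1 s|have := E2 s|have := E3 s]; rewrite !ffunE => /perm_inj.
have psiE (b : bool) (v : 'S_n) (q : 'S_d) (f : W) :
    (forall J f, label_sign J (v \o f) = (-1) ^+ b * label_sign J f) ->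
    psi [ffun s => [ffun s => v (f s)] (q s)] =
      (-1) ^+ b * psi [ffun s => f (q s)].
  move=> bE; rewrite /psi -bE; apply: eq_word_sign => s.
  by rewrite /= !ffunE.
rewrite (reindex_inj HI) /=.
under eq_bigr => u _.
  rewrite /weight /= (psiE c1) // (psiE c2) // (psiE c3) //.
  rewrite /volume (@eq_word_sign _ _ e _
    (h \o cat_word (triple u.1.1 u.1.2 u.2) (triple b1 b2 b3))); last first.
    move=> s; rewrite -[s]splitK; case: (split s) => i /=.
      by rewrite !cat_word_lshift /triple !ffunE.
    by rewrite !cat_word_rshift /triple /h /= /v1 /v2 /v3 !E.
  rewrite cE.
  over.
rewrite /=; apply: contraNneq u0 => u0; apply/eqP.
pose sgn : int := (-1) ^+ c1 * (-1) ^+ c2 * (-1) ^+ c3 * (-1) ^+ c.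
apply: (etrans _ (etrans (congr1 ( *%R sgn) u0) (mulr0 sgn))).
rewrite [RHS]mulr_sumr /sgn; apply: eq_bigr => u _; rewrite /weight /volume.
move: (psi _) (psi _) (psi _) (word_sign _ _) => x y z t.
by case: (c1); case: (c2); case: (c3); case: (c) => /=; ring.
Qed.

(** The volume form vanishes except at the words that enumerate the complement
    of the image of (p1, p2, p3), which are the permutations of (f1, f2, f3). *)
Lemma exists_labels (f1 f2 f3 : W) (p1 p2 p3 : V) :
  injective p1 -> injective p2 -> injective p3 ->
  bijective (cat_word (triple f1 f2 f3) (triple p1 p2 p3)) ->
  exists J1 J2 J3 : 'I_d -> 'I_m,
    \sum_(q : 'S_d) (-1) ^+ q * (label_sign J1 (f1 \o q) *
      label_sign J2 (f2 \o q) * label_sign J3 (f3 \o q)) != 0.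
Proof.
move=> p1I p2I p3I fB.
have [q1 [q2 [q3 w0]]] := weight_volume p1I p2I p3I fB.
exists (fun s => (es (q1^-1 s)%g).1), (fun s => (es (q2^-1 s)%g).1),
  (fun s => (es (q3^-1 s)%g).1).
apply: contraNneq w0 => w0; apply/eqP.
pose H (q : 'S_d) : W * W * W :=
  ([ffun s => f1 (q s)], [ffun s => f2 (q s)], [ffun s => f3 (q s)]).
have HI : injective H.
  move=> q r [/ffunP E1 /ffunP E2 /ffunP E3]; apply/permP => s.
  apply: (@lshift_inj _ n); apply: (bij_inj fB).
  rewrite !cat_word_lshift /triple.
  by have := E1 s; have := E2 s; have := E3 s; rewrite !ffunE => -> -> ->.
have psiE (f : W) (q r : 'S_d) :
    psi [ffun s => [ffun s => f (q s)] (r s)] =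
    (-1) ^+ r * label_sign (fun s => (es (r^-1 s)%g).1) (f \o q).
  rewrite -label_sign_perm /psi; apply: eq_word_sign => s.
  by rewrite /= !ffunE permK.
rewrite (bigID (mem (H @: setT))) /= addrC big1 ?add0r => [|u uH]; last first.
  have [->|v0] := eqVneq (volume e u.1.1 u.1.2 u.2 p1 p2 p3) 0.
    by rewrite mulr0.
  have [q qE] := cat_word_left fB (word_sign_inj v0).
  case/negP: uH; apply/imsetP; exists q => //.
  case: u qE {v0} => [[u1 u2] u3] /= qE.
  by congr (_, _, _); apply/ffunP => s; rewrite ffunE; case: (qE s).
rewrite big_imset /=; last by move=> ? ? _ _; apply: HI.
pose c : int := (-1) ^+ q1 * (-1) ^+ q2 * (-1) ^+ q3 *
  volume e f1 f2 f3 p1 p2 p3.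
apply: (etrans _ (etrans (congr1 ( *%R c) w0) (mulr0 c))).
rewrite [RHS]mulr_sumr /c.
apply: eq_big => [q|q _]; first by rewrite inE.
rewrite /weight /H /= !psiE /volume.
rewrite (@eq_word_sign _ _ e _ (cat_word (triple f1 f2 f3 \o q)
  (triple p1 p2 p3 \o (1%g : 'S_n)))); last first.
  move=> s; rewrite /cat_word; case: split => i.
    by rewrite /triple /= !ffunE.
  by rewrite /= perm1.
rewrite word_sign_cat odd_perm1 expr0 mulr1.
move: (label_sign _ _) (label_sign _ _) (label_sign _ _) (word_sign _ _).
move: ((-1) ^+ q) ((-1) ^+ q1) ((-1) ^+ q2) ((-1) ^+ q3).
move=> z z1 z2 z3 x1 x2 x3 t.
by ring.
Qed.

End Labels.

(** * Covariance of F *)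

Lemma detcols_mulmx (K : comNzRingType) (m : nat) (g : 'M[K]_m)
    (vs : seq 'cV[K]_m) :
  detcols [seq g *m v | v <- vs] = \det g * detcols vs.
Proof.
rewrite /detcols -det_mulmx; congr (\det _); apply/matrixP => a b; rewrite !mxE.
have -> : nth 0 [seq g *m v | v <- vs] b = g *m nth 0 vs b.
  have [ltb|leb] := ltnP b (size vs); first exact: nth_map.
  by rewrite !nth_default ?size_map // mulmx0.
by rewrite mxE; apply: eq_bigr => j _; rewrite mxE.
Qed.

Lemma valH_mulmx (K : comNzRingType) (n : nat) (D : {set point n})
    (g : 'I_3 -> 'M[K]_(mdim n)) (w : 'I_(deg D) -> 'I_3 -> 'cV[K]_(mdim n)) :
  valH (fun s k => g k *m w s k) = (\prod_(k < 3) \det (g k)) ^+ n * valH w.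
Proof.
rewrite /valH -prodrXl -big_split; apply: eq_bigr => k _ /=.
rewrite -[X in _ ^+ X](card_ord n) -prodr_const -big_split.
by apply: eq_bigr => i _ /=; rewrite -detcols_mulmx -map_comp.
Qed.

(** Expanding the action in the basis, the coefficients of [F D w] become values
    of [valH] at the pure tensors g e_Y, by multilinearity. *)
Lemma F_tact (K : comNzRingType) (n : nat) (D : {set point n})
    (g : 'I_3 -> 'M[K]_(mdim n)) (w : tens3 K (mdim n)) :
  is_diagonal D -> F D (tact g w) = (\prod_(k < 3) \det (g k)) ^+ n * F D w.
Proof.
move=> hD; rewrite /F /valL mulr_sumr.
under [RHS]eq_bigr do
  rewrite mulrCA -valH_mulmx -(valL_pure _ hD) /valL mulr_sumr.
rewrite [RHS]exchange_big; apply: eq_bigr => J _ /=.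
under [RHS]eq_bigr do rewrite mulrA.
rewrite -mulr_suml; congr (_ * _); rewrite ffunE.
under eq_bigr do rewrite ffunE.
rewrite bigA_distr_bigA; apply: eq_bigr => Y _.
rewrite !ffunE -big_split; apply: eq_bigr => s _ /=.
rewrite ffunE mulrC; congr (_ * _); apply: eq_bigr => k _.
rewrite mxE (bigD1 (Y s k)) //= mxE !eqxx mulr1 big1 ?addr0 // => j /negbTE jY.
by rewrite mxE jY mulr0.
Qed.

(** * Non-vanishing of F *)

Definition basis_sum (K : comNzRingType) (d m : nat)
    (L : 'I_d -> {ffun 'I_3 -> 'I_m}) (S : {set 'I_d}) : tens3 K m :=
  \sum_(i in S) pure3 (fun k => delta_mx (L i k) 0).

Lemma basis_sumE (K : comNzRingType) (d m : nat)
    (L : 'I_d -> {ffun 'I_3 -> 'I_m}) (S : {set 'I_d}) y :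
  basis_sum K L S y = \sum_(i in S) (y == L i)%:R.
Proof.
rewrite /basis_sum sum_ffunE; apply: eq_bigr => i _; rewrite ffunE.
have [->|/eqP yL] := eqVneq y (L i).
  by rewrite big1 // => k _; rewrite mxE !eqxx.
have [k /negbTE kN] : exists k, y k != L i k.
  apply/existsP; rewrite -negb_forall; apply/forallP => h; apply: yL.
  by apply/ffunP => k; apply/eqP.
by rewrite (bigD1 k) //= mxE kN mul0r.
Qed.

(** Ryser's formula, applied to each coefficient, extracts from [F] at a sum of
    d rank-one tensors the part in which each of them is used exactly once. *)
Lemma F_polarization (K : comNzRingType) (n : nat) (D : {set point n})
    (L : 'I_(deg D) -> {ffun 'I_3 -> 'I_(mdim n)}) :
  \sum_S (-1) ^+ #|~: S| * F D (basis_sum K L S) =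
  \sum_(p : 'S_(deg D))
    valH (fun s k => delta_mx (L (p s) k) 0 : 'cV[K]_(mdim n)).
Proof.
rewrite /F /valL; under eq_bigr do rewrite mulr_sumr.
rewrite exchange_big /=.
transitivity (\sum_(J : {ffun 'I_(deg D) -> {ffun 'I_3 -> 'I_(mdim n)}})
  (\sum_(p : 'S_(deg D)) \prod_s (J s == L (p s))%:R) *
    valH (fun s k => delta_mx (J s k) 0 : 'cV[K]_(mdim n))).
  apply: eq_bigr => J _.
  rewrite -(ryser_formula (fun s i => (J s == L i)%:R)) mulr_suml.
  apply: eq_bigr => S _; rewrite mulrA ffunE; congr (_ * _ * _).
  by apply: eq_bigr => s _; rewrite basis_sumE.
under eq_bigr do rewrite mulr_suml.
rewrite exchange_big; apply: eq_bigr => p _ /=.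
rewrite (bigD1 [ffun s => L (p s)]) //= [X in _ + X]big1 ?addr0 => [|J JL].
  rewrite big1 ?mul1r => [|s _]; last by rewrite ffunE eqxx.
  by apply: eq_bigr => k _; apply: eq_bigr => i _; congr detcols;
    apply: eq_map => s; rewrite ffunE.
have [s /negbTE sN] : exists s, J s != L (p s).
  apply/existsP; rewrite -negb_forall; apply: contra JL => /forallP h.
  by apply/eqP/ffunP => s; rewrite ffunE; apply/eqP.
by rewrite (bigD1 s) //= sN !mul0r.
Qed.

(** On basis vectors each slice determinant is that of the incidence matrix
    between the positions in the slice and the labels; together these diagonal
    blocks form the matrix of the word s |-> (coordinate of s, label of s). *)
Lemma slice_word_sign (K : comNzRingType) (n : nat) (D : {set point n})
    (es : 'I_(deg D) -> 'I_(mdim n) * 'I_n) (k : 'I_3) :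
  is_diagonal D -> bijective es ->
  exists b : bool, forall l : 'I_(deg D) -> 'I_(mdim n),
    \prod_(i < n) detcols [seq delta_mx (l s) 0 : 'cV[K]_(mdim n) |
                           s <- enum (slice D k i)] =
    ((-1) ^+ b * label_sign es l
      (fun s => Defs.coord (Order.enum_val (A := mem (HD D)) s) k))%:~R.
Proof.
move=> hD esB; have cS i := card_slice k i hD.
pose c (s : 'I_(deg D)) := Defs.coord (Order.enum_val (A := mem (HD D)) s) k.
have cP s : s \in slice D k (c s) by rewrite inE.
pose r s : 'I_(mdim n) := cast_ord (cS _) (enum_rank_in (cP s) s).
pose sg i (b : 'I_(mdim n)) : 'I_(deg D) := enum_val (cast_ord (esym (cS i)) b).
pose e s := (c s, r s).
have sgK s : sg (c s) (r s) = s by rewrite /sg /r cast_ordK enum_rankK_in.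
have eB : bijective e.
  exists (fun p => sg p.1 p.2) => [s|[i b]]; first exact: sgK.
  have bS : sg i b \in slice D k i by apply: enum_valP.
  have ci : c (sg i b) = i by move: bS; rewrite inE => /eqP.
  rewrite /e /= ci; congr pair; apply: val_inj; rewrite /r /=.
  by move: (cP (sg i b)); rewrite ci => bS'; rewrite /sg enum_valK_in.
pose sw (t : 'I_(mdim n) * 'I_n) := (t.2, t.1).
have swB : bijective sw by exists (fun t => (t.2, t.1)) => -[].
have [b bE] := word_sign_change (bij_comp swB esB) (bij_inj eB).
exists b => l.
rewrite /label_sign -(word_sign_bij es _ (bij_inj swB)) -bE word_sign_intr.
transitivity (\det (\matrix_(s, t) (if (e s).1 == (e t).1
    then (l (sg (e s).1 (e s).2) == (e t).2)%:R else 0 : K))).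
  rewrite (det_blocks (fun i x y => (l (sg i x) == y)%:R)) //.
  apply: eq_bigr => i _; rewrite /detcols -det_tr; congr (\det _).
  apply/matrixP => x y; rewrite !mxE (nth_map (sg i x)) -?cardE ?cS //.
  by rewrite mxE eqxx andbT eq_sym {2}/sg (enum_val_nth (sg i x)).
congr (\det _); apply/matrixP => s t.
by rewrite !mxE /= sgK xpair_eqE; case: (c s == c t).
Qed.

Lemma exists_enum (T : finType) (N : nat) :
  #|T| = N -> exists e : 'I_N -> T, bijective e.
Proof. by move<-; exists enum_val; apply: enum_val_bij. Qed.

Lemma F_neq0 (K : numDomainType) (n : nat) (D : {set point n}) :
  (0 < n)%N -> is_diagonal D -> exists w : tens3 K (mdim n), F D w != 0.
Proof.
move=> n0 hD; have degE := deg_diag hD.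
have nm : (n * n)%N = (mdim n).+1 by rewrite /mdim subn1 prednK // expn_gt0 n0.
have nle : (n <= n ^ 3)%N by rewrite -[leqLHS]expn1 leq_pexp2l.
have [e eB] : exists e : 'I_(deg D + n) -> 'I_n * 'I_n * 'I_n, bijective e.
  apply: exists_enum; rewrite !card_prod !card_ord degE subnK //.
  by rewrite !expnSr expn0 mul1n.
have [es esB] : exists es : 'I_(deg D) -> 'I_(mdim n) * 'I_n, bijective es.
  apply: exists_enum; rewrite !card_prod !card_ord degE /mdim mulnBl mul1n.
  by rewrite -expnSr.
pose k0 : 'I_3 := ord0; pose k1 : 'I_3 := lift ord0 ord0.
pose k2 : 'I_3 := lift ord0 (lift ord0 ord0).
pose c k : {ffun 'I_(deg D) -> 'I_n} :=
  [ffun s => Defs.coord (Order.enum_val (A := mem (HD D)) s) k].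
have [sigma [tau DE]] := hD.
have ffI (p : 'S_n) : injective (finfun p).
  by move=> i j; rewrite !ffunE; apply: perm_inj.
have coordE i : let x := [tuple i; sigma i; tau i] : point n in
    [/\ Defs.coord x k0 = i, Defs.coord x k1 = sigma i
      & Defs.coord x k2 = tau i].
  by split; rewrite /Defs.coord (tnth_nth i).
have coord_inj (x y : point n) : Defs.coord x k0 = Defs.coord y k0 ->
    Defs.coord x k1 = Defs.coord y k1 -> Defs.coord x k2 = Defs.coord y k2 ->
    x = y.
  move=> e0 e1 e2; apply: eq_from_tnth => k.
  case: k => -[|[|[|//]]] lk.
  - by rewrite (_ : Ordinal lk = k0) //; apply: val_inj.
  - by rewrite (_ : Ordinal lk = k1) //; apply: val_inj.
  - by rewrite (_ : Ordinal lk = k2) //; apply: val_inj.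
(* The points off D followed by the points on D list all n^3 points. *)
pose W := cat_word (triple (c k0) (c k1) (c k2))
  (triple (finfun (1%g : 'S_n)) (finfun sigma) (finfun tau)).
have WB : bijective W.
  apply: inj_card_bij; last first.
    by have := bij_eq_card eB => ->.
  have cE s k : c k s = Defs.coord (Order.enum_val (A := mem (HD D)) s) k.
    by rewrite ffunE.
  have not_diag s i : triple (c k0) (c k1) (c k2) s <>
      triple (finfun (1%g : 'S_n)) (finfun sigma) (finfun tau) i.
    rewrite /triple !cE !ffunE perm1 => -[e0 e1 e2].
    have := Order.enum_valP s; rewrite inE => /negP[].
    rewrite {2}DE; apply/imsetP; exists i => //.
    by have [x0 x1 x2] := coordE i; apply: coord_inj; rewrite ?x0 ?x1 ?x2.
  move=> s s'; rewrite /W -[s]splitK -[s']splitK.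
  case: (split s) => i; case: (split s') => j /=;
    rewrite ?cat_word_lshift ?cat_word_rshift.
  - move=> [] ; rewrite !cE => e0 e1 e2; congr lshift.
    by apply: Order.enum_val_inj; apply: coord_inj.
  - by move/not_diag.
  - by move/esym/not_diag.
  - by rewrite /triple !ffunE !perm1 => -[->].
have [J0 [J1 [J2 J_neq0]]] :=
  exists_labels eB esB nm (ffI _) (ffI _) (ffI _) WB.
pose L s : {ffun 'I_3 -> 'I_(mdim n)} :=
  [ffun k => if k == k0 then J0 s else if k == k1 then J1 s else J2 s].
suff : \sum_(p : 'S_(deg D))
    valH (fun s k => delta_mx (L (p s) k) 0 : 'cV[K]_(mdim n)) != 0.
  rewrite -F_polarization => /sum_neq0[S]; rewrite mulf_eq0 negb_or.
  by case/andP => _; exists (basis_sum K L S).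
have [b0 b0E] := slice_word_sign K k0 hD esB.
have [b1 b1E] := slice_word_sign K k1 hD esB.
have [b2 b2E] := slice_word_sign K k2 hD esB.
(* Permuting the labels by p^-1 amounts to permuting the coordinates by p, up to
   the sign of p in each of the three directions: an odd number of times. *)
rewrite (reindex_inj invg_inj) /=.
pose sgn : int := (-1) ^+ b0 * (-1) ^+ b1 * (-1) ^+ b2.
have sgn0 : sgn != 0 by rewrite !mulf_neq0 ?signr_eq0.
rewrite (_ : \sum_p _ = (sgn * \sum_(q : 'S_(deg D)) (-1) ^+ q *
  (label_sign es J0 (c k0 \o q) * label_sign es J1 (c k1 \o q) *
   label_sign es J2 (c k2 \o q)))%:~R).
  by rewrite intr_eq0 mulf_neq0.
rewrite mulr_sumr rmorph_sum; apply: eq_bigr => p _ /=.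
rewrite /valH 3!big_ord_recl big_ord0 mulr1 -/k0 -/k1 -/k2.
have labE (J : 'I_(deg D) -> 'I_(mdim n)) k :
    label_sign es (fun s => J ((p^-1)%g s)) (c k) =
    (-1) ^+ p * label_sign es J (c k \o p).
  rewrite -odd_permV -label_sign_perm; apply: eq_word_sign => s.
  by rewrite /= permKV.
have E k (J : 'I_(deg D) -> 'I_(mdim n)) b :
    (forall s, L s k = J s) ->
    (forall l, \prod_(i < n) detcols [seq delta_mx (l s) 0 : 'cV[K]_(mdim n) |
                           s <- enum (slice D k i)] =
    ((-1) ^+ b * label_sign es l
      (fun s => Defs.coord (Order.enum_val (A := mem (HD D)) s) k))%:~R) ->
    \prod_(i < n) detcols [seq delta_mx (L ((p^-1)%g s) k) 0 : 'cV[K]_(mdim n) |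
                           s <- enum (slice D k i)] =
    ((-1) ^+ b * ((-1) ^+ p * label_sign es J (c k \o p)))%:~R.
  move=> LJ lE; rewrite lE -labE; congr (_ * _)%:~R; apply: eq_word_sign => s.
  by congr pair; [apply: LJ|rewrite ffunE].
rewrite (E k0 J0 _ _ b0E) => [|s]; last by rewrite ffunE.
rewrite (E k1 J1 _ _ b1E) => [|s]; last by rewrite ffunE.
rewrite (E k2 J2 _ _ b2E) => [|s]; last by rewrite ffunE.
rewrite -!rmorphM; congr (_ %:~R); rewrite /sgn.
by case: (odd_perm p) => /=; ring.
Qed.

Theorem theorem3p10 (R : realType) (n : nat) (hn : (2 <= n)%N)
    (D : {set point n}) (hD : is_diagonal D) :
  [/\ forall (g : 'I_3 -> 'M[R[i]]_(mdim n)) (w : tens3 R[i] (mdim n)),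
        (forall k : 'I_3, g k \in unitmx) ->
        F D (tact g w) = (\prod_(k < 3) \det (g k)) ^+ n * F D w,
      forall (g : 'I_3 -> 'M[R[i]]_(mdim n)) (w : tens3 R[i] (mdim n)),
        (forall k : 'I_3, \det (g k) = 1) ->
        F D (tact g w) = F D w
    & exists w : tens3 R[i] (mdim n), F D w != 0].
Proof.
split=> [g w _|g w g1|]; first exact: F_tact.
  by rewrite F_tact // big1 // expr1n mul1r.
by apply: F_neq0 => //; apply: leq_trans hn.
Qed.
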